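(* Let $\mu \ge 2$ be any cardinal (finite or infinite), and let $A_\mu$ be the metric space of functions defined in the context. (i) (universality) $A_\mu$ is a $\mu$-universal $\mathbb{R}$-tree. (ii) (uniqueness) Any (nonempty) complete $\mathbb{R}$-tree in which every point has valency $\mu$ is isometric to $A_\mu$. (iii) (homogeneity) The metric space $A_\mu$ is homogeneous, i.e. for any two points $a,b\in A_\mu$ there is an isometry of $A_\mu$ onto itself sending $a$ to $b$.
   Context: A geodesic segment $[t_1,t_2]$ joining points $t_1,t_2$ of a metric space $T$ with $a=d_T(t_1,t_2)$ is the image of an isometric inclusion $F:[0,a]\to T$ with $F(0)=t_1$, $F(a)=t_2$. A metric space $T$ is a real tree ($\mathbb{R}$-tree) if any pair of its points can be connected by a unique geodesic segment, and if the union of any two geodesic segments $[x,y],[y,z]\subset T$ having only the endpoint $y$ in common is the geodesic segment $[x,z]$. The valency of a point $t\in T$ is the cardinality of the set of connected components of $T\setminus\{t\}$. An $\mathbb{R}$-tree is $\mu$-universal if any $\mathbb{R}$-tree with valency not greater than $\mu$ at every point can be isometrically embedded into it. The space $A_\mu$: for a cardinal $\mu\ge 2$ let $C_\mu$ be a set containing an element $0$, with $\mathrm{Card}(C_\mu)=\mu$ if $\mu$ is infinite and $\mathrm{Card}(C_\mu)=\mu-1$ if $\mu$ is finite. $A_\mu$ is the set of all functions $f:(-\infty,\rho_f)\to C_\mu$ (with $\rho_f\in\mathbb{R}$ depending on $f$) such that: 1) there exists $\tau_f\le\rho_f$ with $f(t)=0$ for all $t<\tau_f$; 2) $f$ is piecewise-constant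 from the right, i.e. for each $t\in(-\infty,\rho_f)$ there exists $\epsilon>0$ (with $t+\epsilon<\rho_f$) such that $f$ is constant on $[t,t+\epsilon]$. The metric is $$d_{A_\mu}(f_1,f_2)=(\rho_{f_1}-s)+(\rho_{f_2}-s),$$ where $s=\sup\{t\le \min(\rho_{f_1},\rho_{f_2}) : f_1(t')=f_2(t')\ \text{for all } t'<t\}$ is the separation moment of $f_1,f_2$. *)

(* Defs.v *)
From HB Require Import structures.
From mathcomp Require Import all_boot all_order all_algebra.
From mathcomp Require Import all_classical all_reals all_analysis.
From mathcomp Require Import lra.

Set Implicit Arguments.
Unset Strict Implicit.
Unset Printing Implicit Defensive.

Import Order.TTheory GRing.Theory Num.Theory.

Local Open Scope classical_set_scope.
Local Open Scope card_scope.
Local Open Scope ring_scope.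

Definition isometric (R : realType) (S T : metricType R) (f : S -> T) : Prop :=
  forall x y, mdist (f x) (f y) = mdist x y.

Definition isometry_onto (R : realType) (S T : metricType R) (f : S -> T) :
    Prop :=
  isometric f /\ bijective f.

Definition homogeneous (R : realType) (T : metricType R) : Prop :=
  forall a b : T, exists2 f : T -> T, isometry_onto f & f a = b.

(* [completeType] requires a pointed carrier, hence this unpointed version of
   its axiom. *)
Definition complete_metric (R : realType) (T : metricType R) : Prop :=
  forall F : set_system T, ProperFilter F -> cauchy F -> exists x : T, F --> x.

(* A segment is a set of points, so that uniqueness of the segment joining two
   points is equality of images; the values of [F] outside [0, a] are
   irrelevant. *)
Definition geodesic_segment (R : realType) (T : metricType R) (x y : T)
    (S : set T) : Prop :=
  let a := mdist x y in
  exists F : R -> T,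
    [/\ F 0 = x, F a = y,
        {in `[0, a] &, forall s t, mdist (F s) (F t) = `|s - t|} &
        S = F @` [set` `[0, a]]].

Definition real_tree (R : realType) (T : metricType R) : Prop :=
  (forall x y : T, exists! S : set T, geodesic_segment x y S) /\
  (forall (x y z : T) (S1 S2 : set T),
     geodesic_segment x y S1 -> geodesic_segment y z S2 ->
     S1 `&` S2 = [set y] -> geodesic_segment x z (S1 `|` S2)).

(* A cardinal is represented by a type [M]; the valency of [t] is the
   cardinality of the following set of sets. *)
Definition branches (R : realType) (T : metricType R) (t : T) : set (set T) :=
  connected_component (~` [set t]) @` (~` [set t]).

Definition universal_real_tree (M : Type) (R : realType) (T : metricType R) :
    Prop :=
  real_tree T /\
  forall S : metricType R, real_tree S ->
    (forall s : S, branches s #<= [set: M]) ->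
    exists f : S -> T, isometric f.

(* Card C = Card M if M is infinite, Card C = Card M - 1 if M is finite. *)
Definition label_card (M C : Type) : Prop :=
  (infinite_set [set: M] -> [set: C] #= [set: M]) /\
  (forall n, [set: M] #= `I_n -> [set: C] #= `I_n.-1).

(* A function on (-oo, rho) is encoded as a total function whose irrelevant
   values on [rho, +oo) are normalized to [c0], so that equality of records is
   equality of partial functions. *)
Record Aspace (R : realType) (C : Type) (c0 : C) := MkAspace {
  rho : R;
  lab : R -> C;
  lab_out : forall t, rho <= t -> lab t = c0;
  lab_init : exists2 tau, tau <= rho & forall t, t < tau -> lab t = c0;
  lab_rconst : forall t, t < rho -> exists e,
    [/\ 0 < e, t + e < rho & forall u, t <= u <= t + e -> lab u = lab t] }.

Section Aspace_metric.
Context {R : realType} {C : Type} {c0 : C}.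
Local Notation A := (Aspace R c0).
Implicit Types f g h : A.

HB.instance Definition _ := gen_eqMixin A.
HB.instance Definition _ := gen_choiceMixin A.

Definition agree f g : set R :=
  [set t | t <= Num.min (rho f) (rho g) /\
           forall t', t' < t -> lab f t' = lab g t'].

Definition separation f g : R := sup (agree f g).

Definition Adist f g : R :=
  (rho f - separation f g) + (rho g - separation f g).

Lemma Aspace_eq f g : rho f = rho g -> lab f = lab g -> f = g.
Proof.
case: f g => [r l o i c] [r' l' o' i' c'] /= e1 e2.
by subst r' l'; congr MkAspace; exact: Prop_irrelevance.
Qed.

Lemma agree_neq0 f g : agree f g !=set0.
Proof.
have [t1 t1f f0] := lab_init f; have [t2 t2g g0] := lab_init g.
exists (Num.min t1 t2); split; first by rewrite le_min !ge_min t1f t2g orbT.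
by move=> t; rewrite lt_min => /andP[/f0 -> /g0 ->].
Qed.

Lemma agree_has_sup f g : has_sup (agree f g).
Proof.
by split; [exact: agree_neq0 | exists (Num.min (rho f) (rho g)) => t []].
Qed.

Lemma separation_le f g : separation f g <= Num.min (rho f) (rho g).
Proof. by apply: ge_sup; [exact: agree_neq0 | move=> t []]. Qed.

Lemma le_separation f g t : agree f g t -> t <= separation f g.
Proof. exact: (sup_upper_bound (agree_has_sup f g)). Qed.

Lemma separation_agree f g t : t < separation f g -> lab f t = lab g t.
Proof. by move=> /(sup_gt (agree_neq0 f g))[u [_ uP] /uP]. Qed.

Lemma separation_sym f g : separation f g = separation g f.
Proof.
rewrite /separation; congr sup; apply/seteqP.
by split=> t [tm tP]; (split; first by rewrite minC) => u /tP.
Qed.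

Lemma separationxx f : separation f f = rho f.
Proof.
apply/eqP; rewrite eq_le (le_trans (separation_le f f)) ?ge_min ?lexx//=.
by apply: le_separation; split; rewrite ?minxx.
Qed.

Lemma separation_ultra f g h :
  Num.min (separation f g) (separation g h) <= separation f h.
Proof.
have := separation_le f g; have := separation_le g h.
rewrite !le_min => /andP[_ gh] /andP[fg _].
apply: le_separation; split; first by rewrite le_min !ge_min fg gh orbT.
by move=> t; rewrite lt_min => /andP[/separation_agree -> /separation_agree].
Qed.

Lemma Adistxx f : Adist f f = 0.
Proof. by rewrite /Adist separationxx subrr addr0. Qed.

Lemma Adist_eq0 f g : Adist f g = 0 -> f = g.
Proof.
rewrite /Adist => fg; have := separation_le f g.
rewrite le_min => /andP[sf sg].
have rf : rho f = separation f g by lra.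
have rg : rho g = separation f g by lra.
apply: Aspace_eq; first by rewrite rf rg.
apply/funext => t; have [/separation_agree//|st] := ltP t (separation f g).
by rewrite !lab_out ?rf ?rg.
Qed.

Lemma Adist_sym f g : Adist f g = Adist g f.
Proof. by rewrite /Adist separation_sym addrC. Qed.

Lemma Adist_triangle g f h : Adist f h <= Adist f g + Adist g h.
Proof.
have := separation_le f g; have := separation_le g h.
have := separation_ultra f g h; rewrite /Adist.
by rewrite ge_min !le_min => /orP[] ? /andP[? ?] /andP[? ?]; lra.
Qed.

HB.instance Definition _ :=
  isMetric.Build R A Adistxx Adist_eq0 Adist_sym Adist_triangle.

Lemma mdist_AspaceE f g :
  mdist f g = (rho f - separation f g) + (rho g - separation f g).
Proof. by []. Qed.

End Aspace_metric.

(* Main.v *)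
Require Import Defs.
From HB Require Import structures.
From mathcomp Require Import all_boot all_order all_algebra.
From mathcomp Require Import all_classical all_reals all_analysis.
From mathcomp Require Import lra.
From mathcomp Require wochoice.

Set Implicit Arguments.
Unset Strict Implicit.
Unset Printing Implicit Defensive.

Import Order.TTheory GRing.Theory Num.Theory.

Local Open Scope classical_set_scope.
Local Open Scope card_scope.
Local Open Scope ring_scope.

(** Distances in the function space are rho f + rho g minus twice the separation
    moment, and separation moments satisfy an ultrametric inequality. This amounts
    to the four-point condition, and a geodesic space with the four-point condition
    is a real tree ([four_point_real_tree]). Homogeneity is explicit
    ([swap_isometry]): after a translation of the time axis one may assume that
    rho a = rho b, and then exchanging the labels lab a t and lab b t at each time
    t is an isometric involution that sends a to b.

    Universality and uniqueness both come from a description of an arbitrary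
    nonempty real tree T by label functions ([tree_coordinates]). A maximal chain
    of the tree order at a basepoint is a ray that cannot be prolonged, and it
    defines a height h on T, its Busemann function ([busemann_exists]). From every
    point x a ray descends towards the end of the maximal chain, and the rays of x
    and y merge at height s x y with d x y = h x + h y - 2 s x y. So T embeds
    isometrically into the function space if every branch going up from a point p
    gets a label in C such that different branches at p have different labels: x
    goes to the function on the interval ending at h x whose value at t is the
    label at the point of height t of the branch that contains x
    ([path_isometric]). At most one branch at p does not go up; this is the reason
    why C has one element less than M when M is finite ([local_labels]).

    The difficulty is to choose labels at all points at once such that the
    functions obtained are constant to the right of each t and trivial near the
    end. Branches are named by their least elements in a well-order of T, a branch
    keeps its name when its starting point is moved up a little, and labels are
    attached to names by recursion along the well-order ([coherent_labels]).

    If T is complete and all its valencies are the cardinal of M, then heights are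
    unbounded from below and the labels at each point exhaust C. Every function of
    the space is then reached, by going up along the branches that it prescribes
    and passing to limits ([path_surjective]). *)

(** * Betweenness and the four-point condition *)

Section Betweenness.
Context {R : realType} {T : metricType R}.
Local Notation d := (@mdist R T).
Implicit Types (x y z w p q : T) (S : set T) (F : R -> T).

Definition between x p y := d x p + d p y = d x y.

(** Of the three ways to split four points into pairs, the two largest sums of
    distances agree. *)
Definition four_point := forall x y z w,
  d x y + d z w <= d x z + d y w \/ d x y + d z w <= d x w + d y z.

Definition geodesic_space := forall x y t,
  0 <= t <= d x y -> exists2 p, between x p y & d x p = t.

Lemma betweenC x p y : between x p y -> between y p x.
Proof.
by rewrite /between (metric_sym y p) (metric_sym p x) (metric_sym y x) addrC.
Qed.

Lemma between_endl x y : between x x y.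
Proof. by rewrite /between mdistxx add0r. Qed.

Lemma between_endr x y : between x y y.
Proof. by rewrite /between mdistxx addr0. Qed.

Lemma between_le x p y : between x p y -> d x p <= d x y.
Proof. by rewrite /between; have := mdist_ge0 p y; lra. Qed.

Lemma mdist_le0 x y : d x y <= 0 -> x = y.
Proof. by move=> xy; apply: mdist_positivity; have := mdist_ge0 x y; lra. Qed.

(** A path that does not exceed unit speed and covers the distance between its
    ends cannot lose anything on the way. *)
Lemma lipschitz_geodesic x y F : F 0 = x -> F (d x y) = y ->
  (forall s t, 0 <= s -> s <= t -> t <= d x y -> d (F s) (F t) <= t - s) ->
  {in `[0, d x y] &, forall s t, d (F s) (F t) = `|s - t|}.
Proof.
move=> Fx Fy Fst.
have le s t : 0 <= s -> s <= t -> t <= d x y -> d (F s) (F t) = t - s.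
  move=> s0 st ty; have sy := le_trans st ty; have t0 := le_trans s0 st.
  have := Fst _ _ s0 st ty; have := Fst _ _ (lexx 0) s0 sy.
  have := Fst _ _ t0 ty (lexx _); rewrite Fx Fy.
  have := metric_triangle x (F s) y; have := metric_triangle (F s) (F t) y.
  by lra.
move=> s t; rewrite !in_itv/= => /andP[s0 sy] /andP[t0 ty].
have [st|/ltW ts] := leP s t; first by rewrite le// distrC ger0_norm ?subr_ge0.
by rewrite metric_sym le// ger0_norm ?subr_ge0.
Qed.

Lemma concat_geodesic x p y S1 S2 :
  geodesic_segment x p S1 -> geodesic_segment p y S2 -> between x p y ->
  geodesic_segment x y (S1 `|` S2).
Proof.
move=> [F [F0 Fa Fd ->]] [G [G0 Gb Gd ->]] xpy.
have a0 := mdist_ge0 x p; have b0 := mdist_ge0 p y.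
pose H t := if t <= d x p then F t else G (t - d x p).
have HF t : t <= d x p -> H t = F t by rewrite /H => ->.
have HG t : d x p <= t -> H t = G (t - d x p).
  rewrite le_eqVlt /H => /orP[/eqP <-|]; first by rewrite lexx subrr Fa G0.
  by rewrite ltNge => /negbTE ->.
have Hx : H 0 = x by rewrite HF.
have Hy : H (d x y) = y by rewrite HG -?xpy ?lerDl// addrC addKr.
exists H; split => //.
- apply: lipschitz_geodesic => // s t s0 st ty.
  have [tp|pt] := leP t (d x p).
    rewrite !HF//; last exact: le_trans tp.
    by rewrite Fd ?in_itv/=; [rewrite distrC ger0_norm|..]; lra.
  have [sp|ps] := leP s (d x p).
    rewrite HF// HG; last exact: ltW.
    apply: le_trans (metric_triangle _ p _) _.
    have -> : d (F s) p = d x p - s.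
      by rewrite -[in LHS]Fa Fd ?in_itv/=; [rewrite distrC ger0_norm|..]; lra.
    have -> : d p (G (t - d x p)) = t - d x p.
      rewrite /between in xpy.
      have := Gd 0 (t - d x p); rewrite G0 sub0r normrN !in_itv/= => ->; [|lra..].
      by rewrite ger0_norm; lra.
    by lra.
  rewrite !HG; [|lra..].
  rewrite Gd ?in_itv/=; [|rewrite /between in xpy; lra..].
  by rewrite distrC ger0_norm; lra.
- rewrite /between in xpy; apply/seteqP; split => [q [] [t]|q [t]] /=.
  + rewrite in_itv/= => /andP[t0 tp] <-; exists t; last exact: HF.
    by rewrite /= in_itv/=; lra.
  + rewrite in_itv/= => /andP[t0 tp] <-; exists (t + d x p).
      by rewrite /= in_itv/=; lra.
    by rewrite HG ?addrK//; lra.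
  + rewrite in_itv/= => /andP[t0 ty] <-.
    have [tp|pt] := leP t (d x p); [left|right].
      by exists t; rewrite ?HF//= in_itv/= t0.
    by exists (t - d x p); rewrite ?HG//= ?in_itv/=; lra.
Qed.

Lemma segment_between x y S p : geodesic_segment x y S -> S p -> between x p y.
Proof.
move=> [F [F0 Fa Fd ->]] [t /= tI <-]; rewrite /between.
have a0 := mdist_ge0 x y; move: (tI); rewrite in_itv/= => /andP[t0 ta].
have := Fd 0 t; have := Fd t (d x y); rewrite F0 Fa !in_itv/=.
move=> -> //; [|lra..]; move=> ->; [|lra..].
by rewrite sub0r normrN distrC !ger0_norm; lra.
Qed.

Lemma segment_point x y S t : geodesic_segment x y S -> 0 <= t <= d x y ->
  exists2 p, S p & d x p = t.
Proof.
move=> [F [F0 Fa Fd ->]] /andP[t0 ta]; exists (F t).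
  by exists t => //=; rewrite in_itv/= t0.
have := Fd 0 t; rewrite F0 !in_itv/= => ->; [|lra..].
by rewrite sub0r normrN ger0_norm.
Qed.

End Betweenness.

(** * From the four-point condition to real trees *)

Section FourPointTree.
Context {R : realType} {T : metricType R}.
Local Notation d := (@mdist R T).
Hypotheses (fp : @four_point R T) (geo : @geodesic_space R T).
Implicit Types (x y z w p q : T) (S : set T).

(** The four-point condition for the quadruple x, y, p, q forces two points
    between x and y to be as far apart as their distances to x tell. *)
Lemma four_point_between x y p q : between x p y -> between x q y ->
  d p q = `|d x p - d x q|.
Proof.
rewrite /between.
have le u v : d x u + d u y = d x y -> d x v + d v y = d x y ->
    d x u <= d x v -> d u v <= d x v - d x u.
  move=> xuy xvy uv; have := fp x y u v.
  by rewrite (metric_sym y u) (metric_sym y v); lra.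
move=> xpy xqy; have := metric_triangle x p q; have := metric_triangle x q p.
rewrite (metric_sym q p); have [pq|qp] := leP (d x p) (d x q).
  by rewrite distrC ger0_norm; have := le p q xpy xqy pq; lra.
rewrite ger0_norm; have := le q p xqy xpy (ltW qp); rewrite (metric_sym q p);
  by lra.
Qed.

Lemma interval_segment x y : geodesic_segment x y (between x ^~ y).
Proof.
have [F FP] : {F : R -> T & forall t, 0 <= t <= d x y ->
    between x (F t) y /\ d x (F t) = t}.
  apply: (@choice _ _ (fun t p =>
    0 <= t <= d x y -> between x p y /\ d x p = t)).
  move=> t; case: (boolP (0 <= t <= d x y)) => [/geo[p]|_]; last by exists x.
  by exists p.
have a0 := mdist_ge0 x y; exists F; split.
- by apply/esym/mdist_le0; have [|_ ->] := FP 0; rewrite ?lexx ?a0.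
- have [|+ E] := FP (d x y); first by rewrite lexx a0.
  rewrite /between E => E'; apply: mdist_le0; lra.
- move=> s t; rewrite !in_itv/= => sI tI.
  have [sb se] := FP _ sI; have [tb te] := FP _ tI.
  by rewrite (four_point_between sb tb) se te.
- apply/seteqP; split => [p xpy|p [t /=]]; last first.
    by rewrite in_itv/= => /FP[? _] <-.
  have pI : 0 <= d x p <= d x y by rewrite mdist_ge0 between_le.
  have [b e] := FP _ pI; exists (d x p); first by rewrite /= in_itv.
  by apply: mdist_le0; rewrite (four_point_between b xpy) e subrr normr0.
Qed.

(** Segments are unique because a point between x and y is determined by its
    distance to x. *)
Lemma four_point_real_tree : real_tree T.
Proof.
have uniq x y S : geodesic_segment x y S -> S = between x ^~ y.
  move=> Sxy; apply/seteqP; split => p; first exact: segment_between.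
  move=> xpy; have [|q Sq qe] := segment_point (t := d x p) Sxy.
    by rewrite mdist_ge0 between_le.
  suff -> : p = q by [].
  apply: mdist_le0; rewrite (four_point_between xpy (segment_between Sxy Sq)).
  by rewrite qe subrr normr0.
split=> [x y|x y z S1 S2 h1 h2].
  by exists (between x ^~ y); split=> [|S /uniq->//]; exact: interval_segment.
move=> I; apply: (concat_geodesic h1 h2).
(* the branching point of the tripod x, y, z lies on both segments *)
have [|p xpy yp] := geo (x := y) (y := x) (t := (d x y + d y z - d x z) / 2).
  have := metric_triangle x y z; have := metric_triangle y x z.
  by rewrite (metric_sym y x); lra.
have ypz : between y p z.
  move: xpy yp; rewrite /between; have := fp p z x y.
  have := metric_triangle y p z.
  rewrite (metric_sym y x) (metric_sym p y) (metric_sym z y) (metric_sym z x).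
  by lra.
have : [set y] p.
  by rewrite -I (uniq _ _ _ h1) (uniq _ _ _ h2); split=> //; exact: betweenC.
by move=> /= py; move: yp; rewrite /between py mdistxx; lra.
Qed.

End FourPointTree.

(** * The function space is a homogeneous real tree *)

Section FunctionSpace.
Context {R : realType} {C : Type} {c0 : C}.
Local Notation A := (Aspace R c0).
Implicit Types f g h : A.

(** Distances are sums of heights minus twice separation moments, so the
    heights cancel and the inequality is the one of the ultrametric kind between
    separation moments. *)
Lemma Aspace_four_point : @four_point R A.
Proof.
move=> x y z w; rewrite !mdist_AspaceE.
have := separation_ultra x z y; have := separation_ultra x w y.
have := separation_ultra z x w; have := separation_ultra z y w.
rewrite (separation_sym z y) (separation_sym w y) (separation_sym z x).
rewrite !ge_min.
have [le|lt] := leP (separation x z + separation y w)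
                    (separation x y + separation z w); first by left; lra.
by move=> /orP[] ? /orP[] ? /orP[] ? /orP[] ?; right; lra.
Qed.

Lemma truncation f r : r <= rho f ->
  exists2 g : A, rho g = r & forall t, t < r -> lab g t = lab f t.
Proof.
move=> rf; pose l t := if t < r then lab f t else c0.
have lr t : t < r -> l t = lab f t by rewrite /l => ->.
have l_out t : r <= t -> l t = c0 by rewrite /l ltNge => ->.
have l_init : exists2 tau, tau <= r & forall t, t < tau -> l t = c0.
  have [tau _ f0] := lab_init f; exists (Num.min tau r).
    by rewrite ge_min lexx orbT.
  by move=> t; rewrite lt_min => /andP[/f0 ? /lr ->].
have l_rconst t : t < r -> exists e,
    [/\ 0 < e, t + e < r & forall u, t <= u <= t + e -> l u = l t].
  move=> tr; have [e [e0 tef fe]] := lab_rconst (lt_le_trans tr rf).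
  exists (Num.min e ((r - t) / 2)); split.
  - by rewrite lt_min e0; lra.
  - have : Num.min e ((r - t) / 2) <= (r - t) / 2 by rewrite ge_min lexx orbT.
    by lra.
  - have le : Num.min e ((r - t) / 2) <= e by rewrite ge_min lexx.
    have lr2 : Num.min e ((r - t) / 2) <= (r - t) / 2 by rewrite ge_min lexx orbT.
    by move=> u /andP[tu ut]; rewrite !lr ?fe//; lra.
by exists (@MkAspace R C c0 r l l_out l_init l_rconst).
Qed.

(** A segment descends along the truncations of f to the separation moment and
    ascends along those of g; by symmetry the first half is enough. *)
Lemma Aspace_geodesic : @geodesic_space R A.
Proof.
move=> f g; wlog suff half : f g / forall t, 0 <= t <= rho f - separation f g ->
    exists2 p, between f p g & mdist f p = t.
  move=> t /andP[t0]; have [tf _|ft] := leP t (rho f - separation f g).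
    by apply: half; rewrite t0.
  rewrite mdist_AspaceE => td.
  have [|p gpf gp] := half g f (mdist f g - t).
    by rewrite mdist_AspaceE (separation_sym g f); lra.
  exists p; first exact: betweenC.
  by move: gpf; rewrite /between gp (metric_sym g f) (metric_sym p f); lra.
move=> t /andP[t0 tf].
have := separation_le f g; rewrite le_min => /andP[sf sg].
have [|p pr pf] := @truncation f (rho f - t); first by lra.
have fp : separation f p = rho f - t.
  apply/eqP; rewrite eq_le; have := separation_le f p.
  rewrite le_min pr => /andP[_ ->] /=; apply: le_separation; split.
    by rewrite le_min pr; lra.
  by move=> u /pf.
have fpt : mdist f p = t by rewrite mdist_AspaceE fp pr; lra.
have pg : separation f g <= separation p g.
  apply: le_separation; split; first by rewrite le_min pr; lra.
  by move=> u us; rewrite pf; [exact: separation_agree|lra].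
exists p => //; rewrite /between fpt.
have := metric_triangle f p g; rewrite fpt.
by rewrite (mdist_AspaceE p g) (mdist_AspaceE f g) pr; lra.
Qed.

Lemma Aspace_real_tree : real_tree A.
Proof. exact: four_point_real_tree Aspace_four_point Aspace_geodesic. Qed.

(** Moving the time axis and permuting the labels separately at each time
    keeps separation moments, up to the shift. *)
Lemma relabelling_isometry (c : R) (s s' : R -> C -> C) (phi : A -> A) :
  (forall t, cancel (s t) (s' t)) ->
  (forall f, rho (phi f) = rho f + c) ->
  (forall f t, t < rho f -> lab (phi f) (t + c) = s t (lab f t)) ->
  isometric phi.
Proof.
move=> sK phir phil f g; rewrite !mdist_AspaceE !phir.
suff -> : separation (phi f) (phi g) = separation f g + c by lra.
apply/eqP; rewrite eq_le; apply/andP; split.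
  apply: ge_sup; first exact: agree_neq0.
  move=> t [+ tP]; rewrite !phir le_min => /andP[tf tg].
  rewrite -lerBlDr; apply: le_separation; split; first by rewrite le_min; lra.
  move=> u ut; have := tP (u + c); rewrite -ltrBrDr ut => /(_ isT).
  by rewrite !phil; [move=> /(congr1 (s' u)); rewrite !sK|lra..].
have := separation_le f g; rewrite le_min => /andP[sf sg].
apply: le_separation; split; first by rewrite le_min !phir; lra.
move=> u us; rewrite -[u](subrK c) !phil ?(separation_agree (f := f) (g := g))//;
  by lra.
Qed.

Lemma shift_isometry (c : R) : exists2 phi : A -> A, isometry_onto phi &
  forall f, rho (phi f) = rho f + c.
Proof.
have ex (b : R) : {phi : A -> A & forall f, rho (phi f) = rho f + b /\
    forall t, lab (phi f) t = lab f (t - b)}.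
  apply: (@choice _ _ (fun f g => rho g = rho f + b /\
    forall t, lab g t = lab f (t - b))) => f.
  have l_out t : rho f + b <= t -> lab f (t - b) = c0.
    by move=> ft; apply: lab_out; lra.
  have l_init : exists2 tau, tau <= rho f + b &
      forall t, t < tau -> lab f (t - b) = c0.
    have [tau tf f0] := lab_init f; exists (tau + b); first by rewrite lerD2r.
    by move=> t tt; apply: f0; lra.
  have l_rconst t : t < rho f + b -> exists e, [/\ 0 < e, t + e < rho f + b &
      forall u, t <= u <= t + e -> lab f (u - b) = lab f (t - b)].
    move=> tf; have [|e [e0 ef eP]] := @lab_rconst _ _ _ f (t - b); first by lra.
    by exists e; split=> // [|u ut]; [lra|apply: eP; lra].
  by exists (@MkAspace R C c0 _ _ l_out l_init l_rconst).
have [phi phiP] := ex c; have [psi psiP] := ex (- c).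
exists phi; last by move=> f; have [] := phiP f.
split; last first.
  exists psi => f; apply: Aspace_eq.
  - by rewrite (psiP _).1 (phiP _).1 addrK.
  - by apply/funext => t; rewrite (psiP _).2 (phiP _).2 opprK addrK.
  - by rewrite (phiP _).1 (psiP _).1 subrK.
  - by apply/funext => t; rewrite (phiP _).2 (psiP _).2 opprK subrK.
apply: (@relabelling_isometry c (fun _ => id) (fun _ => id)) => // f.
  by have [] := phiP f.
by move=> t _; rewrite (phiP f).2 addrK.
Qed.

Definition transpose (x y z : C) : C :=
  if pselect (z = x) then y else if pselect (z = y) then x else z.

Lemma transposeK x y : involutive (transpose x y).
Proof. by rewrite /transpose => z; do !case: pselect => //= ?; congruence. Qed.

Lemma transpose_l x y : transpose x y x = y.
Proof. by rewrite /transpose; case: pselect. Qed.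

Lemma transposexx x : transpose x x =1 id.
Proof. by rewrite /transpose => z; do !case: pselect => //= ?; congruence. Qed.

(** Swapping the labels of a and b at each time turns a into b; it stays within
    the space because both functions are piecewise constant from the right and
    agree near -oo. *)
Lemma swap_isometry (a b : A) : rho a = rho b ->
  exists2 phi : A -> A, isometry_onto phi & phi a = b.
Proof.
move=> ab; pose s t := transpose (lab a t) (lab b t).
have [phi phiP] : {phi : A -> A & forall f, rho (phi f) = rho f /\
    forall t, t < rho f -> lab (phi f) t = s t (lab f t)}.
  apply: (@choice _ _ (fun f g => rho g = rho f /\
    forall t, t < rho f -> lab g t = s t (lab f t))) => f.
  pose l t := if t < rho f then s t (lab f t) else c0.
  have lr t : t < rho f -> l t = s t (lab f t) by rewrite /l => ->.
  have l_out t : rho f <= t -> l t = c0 by rewrite /l ltNge => ->.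
  have l_init : exists2 tau, tau <= rho f & forall t, t < tau -> l t = c0.
    have [tf tff f0] := lab_init f; have [ta _ a0] := lab_init a.
    have [tb _ b0] := lab_init b; exists (Num.min tf (Num.min ta tb)).
      by rewrite ge_min tff.
    move=> t; rewrite !lt_min => /and3P[tf' /a0 a0' /b0 b0'].
    by rewrite lr ?(lt_le_trans tf')// /s a0' b0' transposexx f0.
  have l_rconst t : t < rho f -> exists e,
      [/\ 0 < e, t + e < rho f & forall u, t <= u <= t + e -> l u = l t].
    move=> tr; have [e [e0 ef fe]] := lab_rconst tr.
    have [d d0 sd] : exists2 d, 0 < d & forall u, t <= u <= t + d -> s u =1 s t.
      have [ta|at_] := ltP t (rho a); last first.
        exists 1 => // u /andP[tu _] z.
        by rewrite /s !lab_out// -?ab ?(le_trans at_).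
      have [d1 [d10 _ d1P]] := lab_rconst ta; rewrite ab in ta.
      have [d2 [d20 _ d2P]] := lab_rconst ta; exists (Num.min d1 d2).
        by rewrite lt_min d10.
      have m1 : Num.min d1 d2 <= d1 by rewrite ge_min lexx.
      have m2 : Num.min d1 d2 <= d2 by rewrite ge_min lexx orbT.
      by move=> u ut z; rewrite /s d1P ?d2P//; lra.
    have m1 : Num.min e d <= e by rewrite ge_min lexx.
    have m2 : Num.min e d <= d by rewrite ge_min lexx orbT.
    exists (Num.min e d); split; first by rewrite lt_min e0.
      by lra.
    by move=> u ut; rewrite !lr ?sd ?fe//; lra.
  by exists (@MkAspace R C c0 _ _ l_out l_init l_rconst); split=> // t /lr.
have phiK : involutive phi.
  move=> f; have [r1 l1] := phiP f; have [r2 l2] := phiP (phi f).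
  rewrite r1 in r2 l2; apply: Aspace_eq => //; apply/funext => t.
  have [tf|ft] := ltP t (rho f); first by rewrite l2// l1// /s transposeK.
  by rewrite !lab_out ?r2.
exists phi.
  split; last by exists phi.
  apply: (@relabelling_isometry 0 s s) => [t|f|f t tf]; first exact: transposeK.
    by rewrite addr0; have [] := phiP f.
  by rewrite addr0 (phiP f).2.
have [ra la] := phiP a; apply: Aspace_eq; first by rewrite ra.
apply/funext => t; have [ta|at_] := ltP t (rho a); last first.
  by rewrite !lab_out// -?ab ?ra.
by rewrite la// /s transpose_l.
Qed.

Lemma Aspace_homogeneous : homogeneous A.
Proof.
move=> a b; have [phi [phi_iso phi_bij] phir] := shift_isometry (rho b - rho a).
have [|psi [psi_iso psi_bij] <-] := @swap_isometry (phi a) b.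
  by rewrite phir; lra.
exists (psi \o phi) => //; split; last exact: bij_comp.
by move=> x y; rewrite /= psi_iso phi_iso.
Qed.

End FunctionSpace.

(** * From real trees to the four-point condition *)

Section RealTree.
Context {R : realType} {T : metricType R}.
Local Notation d := (@mdist R T).
Hypothesis tree : real_tree T.
Implicit Types (x y z w m p q : T) (S : set T).

Lemma tree_segment x y : exists S, geodesic_segment x y S.
Proof. by have [S [] ] := tree.1 x y; exists S. Qed.

Lemma tree_geodesic : @geodesic_space R T.
Proof.
move=> x y t tI; have [S Sxy] := tree_segment x y.
have [p /(segment_between Sxy)] := segment_point Sxy tI.
by exists p.
Qed.

(** A point p between x and y makes the concatenation of segments x, p and p, y
    a segment, so it lies on the unique one. *)
Lemma between_segment x y S p : geodesic_segment x y S -> between x p y -> S p.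
Proof.
move=> Sxy xpy; have [S1 S1xp] := tree_segment x p.
have [S2 S2py] := tree_segment p y; have [S0 [_ uniq]] := tree.1 x y.
rewrite -(uniq _ Sxy) (uniq _ (concat_geodesic S1xp S2py xpy)).
move: S1xp => [F [_ Fa _ ->]]; left; exists (d x p) => //=.
by rewrite in_itv/= mdist_ge0 lexx.
Qed.

Lemma between_dist x y p q : between x p y -> between x q y ->
  d p q = `|d x p - d x q|.
Proof.
move=> xpy xqy; have [S Sxy] := tree_segment x y.
have := between_segment Sxy xpy; have := between_segment Sxy xqy.
move: Sxy => [F [F0 _ Fd ->]] [s sI <-] [t tI <-].
have e u : u \in `[0, d x y] -> d x (F u) = u.
  move=> uI; have := Fd 0 u; rewrite F0 in_itv/= lexx mdist_ge0 => ->//.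
  by move: uI; rewrite in_itv/= => /andP[u0 _]; rewrite sub0r normrN ger0_norm.
by rewrite !e// Fd.
Qed.

Lemma between_nested x y p q :
  between x p y -> between x q y -> d x p <= d x q -> between x p q.
Proof.
move=> xpy xqy pq; rewrite /between (between_dist xpy xqy) distrC.
by rewrite ger0_norm; lra.
Qed.

(** The segments from y to x and from y to z run together for a while and
    separate for good at the point m; beyond m they only share m, hence
    their remainders concatenate to the segment from x to z. *)
Lemma median x y z :
  exists m, [/\ between y m x, between y m z & between x m z].
Proof.
pose I := [set t | exists p, [/\ between y p x, between y p z & d y p = t]].
have I_sup : has_sup I.
  split; first by exists 0, y; split; [exact: between_endl..|exact: mdistxx].
  by exists (d y x) => _ [p [ypx _ <-]]; exact: between_le.
have I_le t : I t -> t <= sup I by apply: sup_upper_bound.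
have I0 : 0 <= sup I.
  by apply: I_le; exists y; split; [exact: between_endl..|exact: mdistxx].
have supI u : (forall t, I t -> t <= u) -> sup I <= u.
  by move=> Iu; apply: ge_sup => //; case: I_sup.
have [|m ymx ym] := tree_geodesic (x := y) (y := x) (t := sup I).
  by rewrite I0 supI// => _ [p [ypx _ <-]]; exact: between_le.
have [|m' ymz ym'] := tree_geodesic (x := y) (y := z) (t := sup I).
  by rewrite I0 supI// => _ [p [_ ypz <-]]; exact: between_le.
have mm' : m = m'.
  apply: mdist_le0; rewrite leNgt; apply/negP => mm'.
  suff : sup I <= sup I - d m m' / 2 by lra.
  apply: supI => t It; have tI := I_le _ It; have [p [ypx ypz yp]] := It.
  have := between_dist ypx ymx; have := between_dist ypz ymz.
  have := metric_triangle m p m'.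
  by rewrite (metric_sym m p) yp ym ym' distrC ger0_norm; lra.
rewrite -mm' in ymz; exists m; split=> //.
have [S1 S1P] := tree_segment x m; have [S2 S2P] := tree_segment m z.
apply: (segment_between (S := S1 `|` S2)); last first.
  left; apply: (between_segment S1P); exact: between_endr.
apply: (tree.2 x m z) => //; apply/seteqP.
split => [q [/(segment_between S1P) xqm]|q ->].
  move=> /(segment_between S2P) mqz.
  (* q is between y and both x and z, so it cannot be farther from y than m *)
  have : I (d y q).
    exists q; split=> //; move: ymx ymz xqm mqz; rewrite /between.
      have := metric_triangle y m q; have := metric_triangle y q x.
      rewrite (metric_sym q x) (metric_sym m x) (metric_sym m q).
      by lra.
    have := metric_triangle y m q; have := metric_triangle y q z.
    by lra.
  move=> /I_le; rewrite -ym => yq; apply: mdist_le0.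
  move: ymx xqm; rewrite /between; have := metric_triangle y q x.
  by rewrite (metric_sym q x) (metric_sym m x); lra.
split; first by apply: (between_segment S1P); exact: between_endr.
by apply: (between_segment S2P); exact: between_endl.
Qed.

(** If m separates x from y, then the segment from m to any w can start along
    at most one of the segments from m to x and to y. *)
Lemma between_or x m y w : between x m y -> between w m x \/ between w m y.
Proof.
have half u v n n' : between u m v -> between m n w -> between m n u ->
    between m n' w -> between m n' v -> d m n <= d m n' -> n = m.
  move=> umv mnw mnu mn'w mn'v nn'.
  have := between_nested mnw mn'w nn' => mnn'.
  have mnv : between m n v.
    move: mnn' mn'v; rewrite /between; have := metric_triangle n n' v.
    by have := metric_triangle m n v; lra.
  apply/esym/mdist_le0; move: umv mnu mnv; rewrite /between.
  by have := metric_triangle u n v; rewrite (metric_sym u n) (metric_sym u m); lra.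
move=> xmy.
have [n [mnw mnx wnx]] := median w m x; have [n' [mn'w mn'y wn'y]] := median w m y.
have [nn'|/ltW n'n] := leP (d m n) (d m n').
  by left; rewrite -(half _ _ _ _ xmy mnw mnx mn'w mn'y nn').
by right; rewrite -(half _ _ _ _ (betweenC xmy) mn'w mn'y mnw mnx n'n).
Qed.

Lemma tree_four_point : @four_point R T.
Proof.
move=> x y z w; have [m [ymx ymz xmz]] := median x y z.
have tri u v : d u v <= d m u + d m v.
  by rewrite (metric_sym m u); exact: metric_triangle.
move: ymz xmz; rewrite /between (metric_sym y m) (metric_sym x m).
have := tri x y; have := tri z w; have := tri x w; have := tri z y.
have [] := between_or w (betweenC ymx); rewrite /between (metric_sym w m).
  by right; rewrite (metric_sym x w); lra.
by left; rewrite (metric_sym y w); lra.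
Qed.

Lemma geodesic_connected x y S : geodesic_segment x y S -> connected S.
Proof.
move=> [F [_ _ Fd ->]]; apply: connected_continuous_connected.
  exact: segment_connected.
apply/subspace_continuousP => t tI.
apply/metricType_numDomainType.cvgrPdist_lt => e e0.
rewrite near_withinE; apply/nbhs_ballP; exists e => //= u.
by rewrite /ball/= => tu uI; rewrite Fd.
Qed.

Lemma separated_trans p x y z : between x p y -> d y z < d p y -> between x p z.
Proof.
move=> xpy yz; have [] := between_or z xpy; first exact: betweenC.
rewrite /between (metric_sym z y) => zpy.
by have := mdist_ge0 z p; lra.
Qed.

(** The points that p separates from x form an open set, and so do the others:
    a connected set avoiding p lies on one side. *)
Lemma connected_not_between p x y S :
  connected S -> ~ S p -> S x -> S y -> ~ between x p y.
Proof.
move=> Sc Sp Sx Sy xpy.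
have near_p z : S z -> 0 < d p z.
  move=> Sz; rewrite mdist_gt0; apply/eqP => pz; by rewrite pz in Sp.
pose V := [set z | between x p z /\ z <> p].
pose W := [set z | ~ between x p z].
have V_open : open V.
  rewrite openE => z [xpz zp]; apply/nbhs_ballP.
  exists (d p z) => /= [|u]; first by rewrite mdist_gt0; apply/eqP => /esym.
  rewrite ballEmdist => /= zu; split; first exact: separated_trans zu.
  by move=> up; move: zu; rewrite up (metric_sym z p) ltxx.
have W_open : open W.
  rewrite openE => z xpz; have zp : 0 < d p z.
    rewrite mdist_gt0; apply/eqP => pz; apply: xpz; rewrite -pz.
    exact: between_endr.
  apply/nbhs_ballP; exists (d p z / 2) => /= [|u]; first by lra.
  rewrite ballEmdist => /= zu xpu; apply: xpz; apply: separated_trans xpu _.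
  by have := metric_triangle p u z; rewrite (metric_sym u z); lra.
have SV : S `&` V = S `&` ~` W.
  apply/seteqP; split => z [Sz]; first by move=> [xpz _]; split=> // /(_ xpz).
  move=> /contrapT xpz; split=> //; split=> // zp; by rewrite zp in Sz.
have : S `&` V = S.
  apply: Sc; last by exists (~` W) => //; exact: open_closedC.
    by exists y; split=> //; split=> // yp; rewrite yp in Sy.
  by exists V.
move=> SVS; have [_ [xpx _]] : (S `&` V) x by rewrite SVS.
move: xpx; rewrite /between mdistxx (metric_sym x p); have := near_p _ Sx.
by lra.
Qed.

Lemma component_eqP p x y : x <> p -> y <> p ->
  connected_component (~` [set p]) x = connected_component (~` [set p]) y <->
  ~ between x p y.
Proof.
move=> xp yp; split=> [xy|xpy].
  apply: (@connected_not_between _ _ _ (connected_component (~` [set p]) x)).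
  - exact: component_connected.
  - by move=> /connected_component_sub; apply.
  - exact: connected_component_refl.
  - by rewrite xy; exact: connected_component_refl.
apply: same_connected_component; have [S Sxy] := tree_segment x y.
exists S.
  split; last exact: geodesic_connected Sxy.
    by apply: (between_segment Sxy); exact: between_endl.
  by move=> z Sz zp; apply: xpy; rewrite -zp; exact: segment_between Sz.
by apply: (between_segment Sxy); exact: between_endr.
Qed.

End RealTree.

(** * Heights measured from a maximal ray *)

Section Completeness.
Context {R : realType} {T : metricType R}.
Local Notation d := (@mdist R T).

(** The superlevel sets of k shrink to diameter 0, hence they generate a Cauchy
    filter; its limit is the upper end of the ray X. *)
Lemma complete_sup_limit (X : set T) (k : T -> R) :
  complete_metric T -> has_sup (k @` X) ->
  (forall x y, X x -> X y -> d x y = `|k x - k y|) ->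
  exists e, forall x, X x -> d x e = sup (k @` X) - k x.
Proof.
move=> Tc kX Xd; set K := sup _.
have kle x : X x -> k x <= K by move=> Xx; apply: sup_upper_bound => //; exists x.
have kgt eps : 0 < eps -> exists2 x, X x & K - eps < k x.
  move=> e0; have [|_ [x Xx <-] kx] := @sup_gt _ (k @` X) (K - eps) kX.1.
    by rewrite -/K; lra.
  by exists x.
pose F : set_system T :=
  filter_from [set eps : R | 0 < eps] (fun eps => [set x | X x /\ K - eps < k x]).
have FF : ProperFilter F.
  apply: filter_from_proper; last by move=> eps /kgt[x]; exists x.
  apply: filter_from_filter; first by exists 1 => /=.
  move=> i j /= i0 j0; exists (Num.min i j) => /=; first by rewrite lt_min i0.
  have mi : Num.min i j <= i by rewrite ge_min lexx.
  have mj : Num.min i j <= j by rewrite ge_min lexx orbT.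
  by move=> x [Xx kx]; split; split=> //; lra.
have [|e Fe] := Tc F FF.
  apply: cauchy_exP => eps /= eps0; have [x Xx kx] := kgt _ eps0; exists x.
  exists eps => //= y [Xy ky]; rewrite ballEmdist /= Xd//.
  by have := kle _ Xx; have := kle _ Xy; rewrite ltr_norml; lra.
exists e => x Xx; apply/eqP; rewrite -subr_eq0 -normr_le0.
apply/ler_addgt0Pl => eps eps0; rewrite addr0 ler_norml.
have [|a /= a0 aP] := Fe (ball e (eps / 3)).
  by apply: nbhsx_ballx; lra.
have [|y Xy ky] := kgt (Num.min a (eps / 3)); first by rewrite lt_min a0; lra.
have ma : Num.min a (eps / 3) <= a by rewrite ge_min lexx.
have me : Num.min a (eps / 3) <= eps / 3 by rewrite ge_min lexx orbT.
have : ball e (eps / 3) y by apply: aP; split=> //; lra.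
rewrite ballEmdist /= => ey; have := kle _ Xx; have := kle _ Xy.
have := metric_triangle x y e; have := metric_triangle x e y.
rewrite (metric_sym y e) (Xd _ _ Xx Xy).
by have [xy|xy] := leP (k x) (k y);
  [rewrite distrC ger0_norm|rewrite ger0_norm]; lra.
Qed.

End Completeness.

Section Height.
Context {R : realType} {T : metricType R}.
Local Notation d := (@mdist R T).

(** The height at which the descending rays of x and y merge, for a height
    function h whose descending rays all lead to the same end of the tree. *)
Definition meet_height (h : T -> R) x y := (h x + h y - d x y) / 2.

(** What is used of a Busemann function, the distance to a far point of a ray up
    to a constant. The first property is the four-point condition with the end of
    the ray as the fourth point, the last one is the median of x, y and the end. *)
Record busemann (h : T -> R) : Prop := Busemann {
  meet_height_ultra : forall x y z,
    Num.min (meet_height h x y) (meet_height h y z) <= meet_height h x z;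
  height_lipschitz : forall x y, h x - h y <= d x y;
  meet_exists : forall x y, exists z, [/\ h z = meet_height h x y,
    d x z = h x - h z & d y z = h y - h z] }.

Hypothesis tree : real_tree T.
Variable r : T.
Implicit Types (x y z p g : T) (G : set T).

(** The order of the tree rooted at r. *)
Local Notation below x y := (between r x y).

Definition radial G := forall x y, G x -> G y -> below x y \/ below y x.

Lemma below_trans x y z : below x y -> below y z -> below x z.
Proof.
rewrite /between; have := metric_triangle r x z.
by have := metric_triangle x y z; lra.
Qed.

(** A maximal chain is a ray from r that cannot be prolonged: it is infinite, or
    it ends at a leaf, or the point where it should end is missing. *)
Lemma maximal_radial : exists2 G, radial G &
  forall x, (forall g, G g -> below x g \/ below g x) -> G x.
Proof.
have [F FP totF|G [Gr Gmax]] := @Zorn_bigcup T radial.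
  move=> x y [A FA Ax] [B FB By]; case: (totF _ _ FA FB) => [AB|BA].
    by apply: (FP _ FB) => //; exact: AB.
  by apply: (FP _ FA) => //; exact: BA.
exists G => // x xG; apply: contrapT => Gx.
apply: (Gmax (G `|` [set x])).
  split; first by move=> y; left.
  by move=> /(_ x) Gx'; apply: Gx; apply: Gx'; right.
move=> y z [Gy|->] [Gz|->]; [exact: Gr| |exact: xG|].
  by have [] := xG _ Gy; [right|left].
by left; exact: between_endr.
Qed.

Section MaximalRadial.
Variable G : set T.
Hypotheses (Gr : radial G)
  (Gmax : forall x, (forall g, G g -> below x g \/ below g x) -> G x).

(** From g on, the segments from x to the points of G pass through g, so that
    d x g' - d r g' no longer depends on g'. *)
Definition tail x g := G g /\ forall g', G g' -> below g g' -> between x g g'.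

(** If some g in G is not on the segment from r to x, then the segments from g
    to x and to the later points of G start apart. Otherwise x lies beyond all
    of G, hence in G. *)
Lemma tail_exists x : exists g, tail x g.
Proof.
have [xG|/existsNP[g /not_implyP[Gg gx]]] := pselect (forall g, G g -> below g x).
  exists x; split=> [|g' _ _]; last exact: between_endl.
  by apply: Gmax => g /xG; right.
exists g; split=> // g' Gg' gg'.
by have [/betweenC/gx|] := between_or tree x gg'.
Qed.

Lemma tail_later x g g1 : tail x g -> G g1 -> below g g1 -> tail x g1.
Proof.
move=> [Gg xg] Gg1 gg1; split=> // g' Gg' g1g'.
have := xg _ Gg1 gg1; have := xg _ Gg' (below_trans gg1 g1g').
move: gg1 g1g'; rewrite /between; have := metric_triangle g g1 g'.
by have := metric_triangle x g1 g'; have := metric_triangle r g g'; lra.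
Qed.

Lemma common_tail x y : exists2 g, tail x g & tail y g.
Proof.
have [g xg] := tail_exists x; have [g' yg'] := tail_exists y.
have [gg'|g'g] := Gr xg.1 yg'.1.
  by exists g' => //; exact: (tail_later xg yg'.1 gg').
by exists g => //; exact: (tail_later yg' xg.1 g'g).
Qed.

Lemma common_tail3 x y z : exists g, [/\ tail x g, tail y g & tail z g].
Proof.
have [g xg yg] := common_tail x y; have [g' zg'] := tail_exists z.
have [gg'|g'g] := Gr xg.1 zg'.1.
  exists g'; split=> //; first exact: (tail_later xg zg'.1 gg').
  exact: (tail_later yg zg'.1 gg').
by exists g; split=> //; exact: (tail_later zg' xg.1 g'g).
Qed.

Definition height_at x g := d x g - d r g.

Lemma tail_height x g g' : tail x g -> tail x g' -> height_at x g = height_at x g'.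
Proof.
rewrite /height_at => -[Gg xg] [Gg' xg'].
have [gg'|g'g] := Gr Gg Gg'.
  by have := xg _ Gg' gg'; move: gg'; rewrite /between; lra.
by have := xg' _ Gg g'g; move: g'g; rewrite /between; lra.
Qed.

Lemma height_exists :
  exists h : T -> R, forall x g, tail x g -> h x = height_at x g.
Proof.
have [f fP] := choice tail_exists.
by exists (fun x => height_at x (f x)) => x g; exact: tail_height.
Qed.

Variable h : T -> R.
Hypothesis hE : forall x g, tail x g -> h x = height_at x g.

Lemma height_busemann : busemann h.
Proof.
split=> [x y z|x y|x y].
- have [g [xg yg zg]] := common_tail3 x y z.
  rewrite /meet_height (hE xg) (hE yg) (hE zg) /height_at ge_min.
  have [] := tree_four_point tree x z y g; rewrite ?(metric_sym z y) => ?.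
    by apply/orP; left; lra.
  by apply/orP; right; lra.
- have [g xg yg] := common_tail x y; rewrite (hE xg) (hE yg) /height_at.
  by have := metric_triangle x y g; lra.
- have [g xg yg] := common_tail x y.
  have [m [gmx gmy xmy]] := median tree x g y.
  have mg : tail m g.
    split=> [|g' Gg' gg']; first exact: xg.1.
    have := xg.2 _ Gg' gg'; move: gmx; rewrite /between.
    have := metric_triangle x m g'; have := metric_triangle m g g'.
    by rewrite (metric_sym g m) (metric_sym m x) (metric_sym g x); lra.
  exists m; rewrite /meet_height (hE xg) (hE yg) (hE mg) /height_at.
  move: gmx gmy xmy; rewrite /between (metric_sym g m) (metric_sym m x).
  by rewrite (metric_sym g x) (metric_sym g y) (metric_sym m y); split; lra.
Qed.

(** A lowest point is the last point of G; a point separated by it from the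
    basepoint would prolong G. *)
Lemma lowest_end p x y : (forall z, h p <= h z) -> x <> p -> y <> p ->
  ~ between x p y.
Proof.
move=> p_low xp yp xpy.
have hG g : G g -> h g = - d r g.
  move=> Gg; rewrite (@hE g g) /height_at ?mdistxx ?sub0r//.
  by split=> // g' _ _; exact: between_endl.
have [g pg] := tail_exists p; have Gg := pg.1.
have pg_eq : p = g.
  apply: mdist_le0; have := p_low g; rewrite (hE pg) (hG _ Gg) /height_at; lra.
rewrite -{}pg_eq in Gg => {pg g}.
have G_below g : G g -> below g p.
  move=> Gg'; have [//|pg] := Gr Gg' Gg.
  have := p_low g; rewrite !hG// => ?; have -> : g = p; last exact: between_endr.
  by apply/esym/mdist_le0; move: pg; rewrite /between; lra.
have beyond z : z <> p -> ~ below p z.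
  move=> zp pz; apply: zp; have Gz : G z.
    by apply: Gmax => g /G_below gp; right; exact: below_trans pz.
  apply: mdist_le0; have := between_le (G_below _ Gz).
  by move: pz; rewrite /between (metric_sym z p); lra.
have [/betweenC|] := between_or tree r xpy => rpz; last exact: beyond rpz.
by apply: (beyond _ xp); exact: betweenC.
Qed.

(** If heights are bounded from below, then G is bounded; completeness provides
    its upper end, which belongs to G by maximality and is the lowest point. *)
Lemma complete_lowest c : complete_metric T -> (forall x, c <= h x) ->
  exists p, forall x, h p <= h x.
Proof.
move=> Tc hc.
have hG g : G g -> h g = - d r g.
  move=> Gg; rewrite (@hE g g) /height_at ?mdistxx ?sub0r//.
  by split=> // g' _ _; exact: between_endl.
have Grr : G r by apply: Gmax => g _; left; exact: between_endl.
have [||e eP] := @complete_sup_limit _ _ G (d r) Tc.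
- split; first by exists (d r r), r.
  by exists (- c) => _ [g Gg <-]; have := hc g; rewrite hG//; lra.
- move=> x y Gx Gy; have [|] := Gr Gx Gy => xy; move: (xy); rewrite /between.
    by have := between_le xy; move=> ? ?; rewrite distrC ger0_norm; lra.
  have := between_le xy; rewrite (metric_sym y x) => ? ?.
  by rewrite ger0_norm; lra.
have re : d r e = sup [set d r x | x in G] by rewrite eP// mdistxx subr0.
have G_below g : G g -> below g e.
  by move=> Gg; rewrite /between re (eP _ Gg); lra.
have Ge : G e by apply: Gmax => g /G_below; right.
exists e => x; have [g xg] := tail_exists x.
rewrite (hE xg) (hG _ Ge) /height_at; have := between_le (G_below _ xg.1).
by have := mdist_ge0 x g; lra.
Qed.

End MaximalRadial.

Lemma busemann_exists : exists h : T -> R, [/\ busemann h,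
  forall p x y, (forall z, h p <= h z) -> x <> p -> y <> p -> ~ between x p y &
  forall c, complete_metric T -> (forall x, c <= h x) ->
    exists p, forall x, h p <= h x].
Proof.
have [G Gr Gmax] := maximal_radial; have [h hE] := height_exists Gr Gmax.
exists h; split; first exact: height_busemann Gr Gmax _ hE.
  by move=> p x y; exact: (lowest_end Gr Gmax hE).
by move=> c; exact: (complete_lowest Gr Gmax hE).
Qed.

End Height.

(** * Removing one point from a cardinal *)

Section Cardinals.
Implicit Types U V M C : Type.

Lemma card_le_inj U V (v0 : V) (A : set U) (B : set V) : A #<= B ->
  exists j : U -> V, set_inj A j.
Proof.
move=> AB; pose V' : pointedType :=
  HB.pack V (gen_eqMixin V) (gen_choiceMixin V) (isPointed.Build V v0).
have /(@pcard_leP U V' A B)[j] := AB.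
by exists j; exact: inj.
Qed.

Lemma card_eq_bij U V (v0 : V) (A : set U) (B : set V) : A #= B ->
  exists j : U -> V, set_bij A B j.
Proof.
move=> AB; pose V' : pointedType :=
  HB.pack V (gen_eqMixin V) (gen_choiceMixin V) (isPointed.Build V v0).
by have /(@card_set_bijP U V' A B) := AB.
Qed.

Lemma bij_card_eq U V (A : set U) (B : set V) (f : U -> V) :
  set_bij A B f -> A #= B.
Proof. by move=> /Pbij[g _]; exact: pcard_eq g. Qed.

Lemma card_eq_compl1 M (a b : M) : [set~ a] #= [set~ b].
Proof.
apply: (@bij_card_eq _ _ _ _ (transpose a b)); split.
- by move=> x /= xa; rewrite /transpose; do !case: pselect => //=; congruence.
- by move=> x y _ _ /(can_inj (transposeK a b)).
- move=> y /= yb; exists (transpose a b y); last exact: transposeK.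
  by rewrite /transpose /=; do !case: pselect => //=; congruence.
Qed.

(** An infinite type contains a copy of the natural numbers, which the
    successor maps into itself, missing its first element. *)
Lemma infinite_compl1 M :
  infinite_set [set: M] -> exists a : M, [set~ a] #= [set: M].
Proof.
move=> /[dup] /infinite_setN0[m _] /infiniteP /(card_le_inj m)[i iI].
have i_inj k l : i k = i l -> k = l by move=> /iI; apply; rewrite in_setT.
pose g x := if pselect (exists k, x = i k) is left e
            then i (projT1 (cid e)).+1 else x.
have gi k : g (i k) = i k.+1.
  rewrite /g; case: pselect => [e|[]]; last by exists k.
  by case: cid => l /= /i_inj ->.
have gN x : ~ (exists k, x = i k) -> g x = x by rewrite /g; case: pselect.
exists (i 0%N); apply: card_esym; apply: (card_eq_trans _ (_ : range g #= _)).
  apply: card_esym; apply: inj_card_eq => x y _ _.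
  have [[k ->]|xN] := pselect (exists k, x = i k);
    have [[l ->]|yN] := pselect (exists k, y = i k);
    rewrite ?gi ?(gN x)// ?(gN y)//.
  - by move=> /i_inj[->].
  - by move=> yk; case: yN; exists k.+1.
  - by move=> xl; case: xN; exists l.+1.
suff -> : range g = [set~ i 0%N] by exact: card_eqxx.
apply/seteqP; split => [_ [x _ <-] /=|x /= xi0].
  have [[k ->]|xN] := pselect (exists k, x = i k).
    by rewrite gi => /i_inj.
  by rewrite gN// => xi; apply: xN; exists 0%N.
have [[[|k] xk]|xN] := pselect (exists k, x = i k) => //.
  by exists (i k) => //; rewrite gi.
by exists x => //; exact: gN.
Qed.

(** It is enough to remove some point of one's choice, since a transposition
    moves it to m0. *)
Lemma label_card_compl1 M C (m0 : M) : label_card M C -> [set~ m0] #= [set: C].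
Proof.
move=> [CM_inf CM_fin].
suff [a aC] : exists a : M, [set~ a] #= [set: C].
  exact: card_eq_trans (card_eq_compl1 m0 a) aC.
have [[n Mn]|Minf] := pselect (finite_set [set: M]).
  have Cn := CM_fin _ Mn; case: n => [|n] in Mn Cn.
    move: Mn; rewrite II0 card_eq0 => /eqP M0.
    by have : [set: M] m0 by []; rewrite M0.
  have /eq_cardSP[a _ aM] := Mn; exists a; rewrite setTD in aM.
  by apply: card_eq_trans aM _; rewrite card_eq_sym.
have [a aM] := infinite_compl1 Minf; exists a; apply: card_eq_trans aM _.
by rewrite card_eq_sym; exact: CM_inf.
Qed.

End Cardinals.

(** * Branches above a point *)

Section Branches.
Context {R : realType} {T : metricType R} (h : T -> R).
Hypothesis hB : busemann h.
Local Notation d := (@mdist R T).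
Local Notation s := (meet_height h).
Implicit Types (x y z p q : T).

Lemma meet_heightC x y : s x y = s y x.
Proof. by rewrite /meet_height (metric_sym x y) (addrC (h x)). Qed.

Lemma meet_heightxx x : s x x = h x.
Proof. by rewrite /meet_height mdistxx subr0; lra. Qed.

Lemma meet_height_lel x y : s x y <= h x.
Proof.
by rewrite /meet_height; have := height_lipschitz hB y x; rewrite metric_sym; lra.
Qed.

Lemma meet_height_ler x y : s x y <= h y.
Proof. by rewrite meet_heightC meet_height_lel. Qed.

Lemma meet_height_trans u x y z : u <= s x y -> u <= s y z -> u <= s x z.
Proof.
move=> xy yz; apply: le_trans (meet_height_ultra hB x y z).
by rewrite le_min xy.
Qed.

Lemma meet_height_gtrans u x y z : u < s x y -> u < s y z -> u < s x z.
Proof.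
move=> xy yz; apply: lt_le_trans (meet_height_ultra hB x y z).
by rewrite lt_min xy.
Qed.

(** The point p lies on the ray that descends from x to the end. *)
Definition above p x := s x p = h p.

Lemma above_refl p : above p p.
Proof. exact: meet_heightxx. Qed.

Lemma above_le p x : h p <= s x p -> above p x.
Proof. by move=> px; apply/eqP; rewrite eq_le px meet_height_ler. Qed.

Lemma above_height p x : above p x -> h p <= h x.
Proof. by move=> <-; exact: meet_height_lel. Qed.

Lemma above_dist p x : above p x -> d x p = h x - h p.
Proof. by rewrite /above /meet_height; lra. Qed.

Lemma above_meet p x y : above p x -> above p y -> h p <= s x y.
Proof.
by move=> px py; apply: (@meet_height_trans _ _ p); rewrite ?px// meet_heightC py.
Qed.

Lemma above_trans p q x : above p q -> above q x -> above p x.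
Proof.
move=> pq qx; apply: above_le; apply: (@meet_height_trans _ _ q); rewrite ?pq//.
by rewrite qx; exact: above_height.
Qed.

Lemma above_unique p q x : above p x -> above q x -> h p = h q -> p = q.
Proof.
move=> px qx pq; apply: mdist_le0.
have : h p <= s p q.
  by apply: (@meet_height_trans _ _ x); rewrite ?qx 1?meet_heightC ?px ?pq ?qx.
by rewrite /meet_height; lra.
Qed.

Lemma above_lt p x : above p x -> x <> p -> h p < h x.
Proof.
move=> px xp; rewrite lt_neqAle above_height// andbT; apply/eqP => e.
by apply: xp; apply/esym; apply: (above_unique px (above_refl x)).
Qed.

Lemma above_meet_height p x y : h p <= s x y -> above p x -> above p y.
Proof.
move=> xy px; apply: above_le; apply: (@meet_height_trans _ _ x); rewrite ?px//.
by rewrite meet_heightC.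
Qed.

Lemma meet_point x y : exists z, [/\ h z = s x y, above z x & above z y].
Proof.
have [z [hz xz yz]] := meet_exists hB x y; exists z.
by move: hz; rewrite /above /meet_height => hz; split; lra.
Qed.

Lemma between_above p x y : above p x -> above p y ->
  between x p y <-> s x y = h p.
Proof.
move=> /above_dist px /above_dist; rewrite metric_sym => py.
by rewrite /between px py /meet_height; split; lra.
Qed.

(** At p, all points that are not above p lie in a single branch, the one
    leading to the end that heights are measured from. *)
Lemma between_not_above p x y : ~ above p x -> ~ between x p y <-> ~ above p y.
Proof.
have lt z : ~ above p z -> s z p < h p.
  by move=> zp; rewrite lt_neqAle meet_height_ler andbT; apply/eqP.
move=> xp; split=> [xpy py|yp]; last first.
  have := meet_height_ultra hB x p y; have := lt _ xp; have := lt _ yp.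
  rewrite (meet_heightC p y) ge_min /between (metric_sym p y) /meet_height.
  by move=> ? ? /orP[] ? ?; lra.
apply: xpy; have := lt _ xp; have := meet_height_ultra hB x y p.
have := meet_height_ultra hB x p y; rewrite (meet_heightC p y) py.
rewrite !ge_min => /orP[]; last by lra.
move=> h1 /orP[]; last by move=> ? ?; lra.
move: py h1; rewrite /above /between /meet_height (metric_sym p y); lra.
Qed.

End Branches.

Section LocalLabels.
Context {R : realType} {T : metricType R} (h : T -> R).
Hypotheses (tree : real_tree T) (hB : busemann h).
Implicit Types (x y z p q : T).
Local Notation s := (meet_height h).

(** The points of the branches at p that do not lead to the end. *)
Definition up p x := above h p x /\ x <> p.

Definition separates_branches {C : Type} p (l : T -> C) :=
  forall x y, up p x -> up p y -> l x = l y <-> h p < s x y.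

Definition hits_all {C : Type} p (l : T -> C) :=
  forall c, exists2 x, up p x & l x = c.

Lemma component_up p x y : up p x -> up p y ->
  connected_component (~` [set p]) x = connected_component (~` [set p]) y <->
  h p < s x y.
Proof.
move=> [px xp] [py yp]; rewrite component_eqP// (between_above px py).
rewrite lt_neqAle above_meet// andbT; split=> [e|/eqP e].
  by apply/eqP => /esym.
by move=> /esym.
Qed.

(** The branches at p that do not lead to the end of the height function can be
    labelled by C: the branch leading to that end accounts for the one element
    that C may lack; at a lowest point there is no such branch, but there is at
    most one branch at all. *)
Lemma local_labels (M C : Type) (c0 : C) p :
  label_card M C -> branches p #<= [set: M] ->
  (forall x y, (forall z, h p <= h z) -> x <> p -> y <> p -> ~ between x p y) ->
  exists2 l : T -> C, separates_branches p l &
    (branches p #= [set: M] -> (exists z, h z < h p) -> hits_all p l).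
Proof.
move=> CM pM p_end; pose cc := connected_component (~` [set p]).
have [[z zp]|/forallNP zp] := pselect (exists z, ~ above h p z); last first.
  have p_low z : h p <= h z by apply: above_height => //; exact: contrapT.
  exists (fun _ => c0); last by move=> _ [z]; rewrite ltNge p_low.
  move=> x y [px xp] [py yp]; split=> // _; rewrite lt_neqAle above_meet// andbT.
  by apply/eqP => /esym /(between_above px py); exact: p_end.
have zNp : z <> p by move=> e; apply: zp; rewrite e; exact: above_refl.
have [m0] : exists m : M, True.
  have := pM; apply: contraPP => /forallNP M0.
  have -> : [set: M] = set0 by apply/seteqP; split=> // m; have := M0 m.
  by rewrite card_le0 => /eqP b0; have : branches p (cc z);
    [exists z|rewrite b0].
move=> _; have [j j_inj j_surj] : exists2 j : set T -> M, set_inj (branches p) j &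
    branches p #= [set: M] -> set_surj (branches p) [set: M] j.
  have [/(card_eq_bij m0)[j [_ ? ?]]|NpM] := pselect (branches p #= [set: M]).
    by exists j.
  by have [j ?] := card_le_inj m0 pM; exists j.
have [phi [_ phi_inj phi_surj]] :=
  card_eq_bij c0 (label_card_compl1 (j (cc z)) CM).
have cc_branch x : x <> p -> branches p (cc x) by exists x.
have j_eq x y : x <> p -> y <> p -> j (cc x) = j (cc y) <-> ~ between x p y.
  move=> xp yp; rewrite -component_eqP// -/cc; split=> [|->//].
  by apply: j_inj; apply: mem_set; exact: cc_branch.
have jz x : up p x -> j (cc x) <> j (cc z).
  move=> [px xp] /esym /(j_eq _ _ zNp xp) /(between_not_above hB _ zp); exact.
exists (phi \o j \o cc) => [x y px py|pM_eq _ c].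
  rewrite -component_up//; split=> [/= e|/(congr1 (phi \o j))//].
  apply: j_inj; rewrite ?inE;
    [by apply: cc_branch; case: px|by apply: cc_branch; case: py|].
  by apply: phi_inj => //; apply: mem_set => /=; exact: jz.
have [m mz <-] := phi_surj c I; have [_ [x xp <-] xm] := j_surj pM_eq m I.
exists x; last by rewrite /= xm.
split=> //; apply: contrapT => /(between_not_above hB x zp) /(j_eq _ _ zNp xp) e.
by apply: mz; rewrite e xm.
Qed.

End LocalLabels.

(** * Labels that are locally constant along rays *)

Section WellOrder.

Lemma well_order_strict (T : eqType) : exists lt : T -> T -> Prop,
  well_founded lt /\ forall x y, ~ lt x y -> ~ lt y x -> x = y.
Proof.
have [W Wwo] := wochoice.well_ordering_principle T.
exists (fun x y => ~~ W y x); split; last first.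
  move=> x y /negP/negPn yx /negP/negPn xy.
  have Wxx z : W z z.
    have [|_ [[/eqP-> +] _]] := Wwo (pred1 z); first by exists z; exact: eqxx.
    by apply; exact: eqxx.
  have [|z [_ z_uniq]] := Wwo (pred2 x y); first by exists x; rewrite inE eqxx.
  rewrite -(z_uniq x) ?(z_uniq y)//; split; rewrite ?inE ?eqxx ?orbT//.
    by move=> _ /pred2P[->|->].
  by move=> _ /pred2P[->|->].
move=> x0; apply: contrapT => Nx0.
have [|x [[xN x_min] _]] := Wwo (fun x => `[< ~ Acc (fun x y => ~~ W y x) x >]).
  by exists x0; apply/asboolP.
move/asboolP : xN; apply; constructor => y yx; apply: contrapT => yN.
by move: yx; rewrite x_min//; apply/asboolP.
Qed.

Definition least {T : Type} (lt : T -> T -> Prop) (A : set T) m :=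
  A m /\ forall y, A y -> ~ lt y m.

Lemma least_exists {T : Type} (lt : T -> T -> Prop) (A : set T) :
  well_founded lt -> A !=set0 -> exists m, least lt A m.
Proof.
move=> wf [x Ax]; elim/(well_founded_ind wf) : x Ax => x IH Ax.
have [[y Ay yx]|N] := pselect (exists2 y, A y & lt y x); first exact: IH yx Ay.
by exists x; split=> // y Ay yx; apply: N; exists y.
Qed.

(** Recursion along lt, where P p m selects at most one p for each m and the
    value at m is computed from the one at k p. *)
Lemma well_founded_recursion {T S C : Type} (lt : T -> T -> Prop)
    (P : S -> T -> Prop) (k : S -> T) (F : S -> T -> C -> C) (c0 : C) :
  well_founded lt -> (forall p m, P p m -> lt (k p) m) ->
  (forall p q m, P p m -> P q m -> p = q) ->
  exists l : T -> C, (forall m, (forall p, ~ P p m) -> l m = c0) /\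
    forall p m, P p m -> l m = F p m (l (k p)).
Proof.
move=> wf Plt Puniq.
pose G m (rec : forall y, lt y m -> C) : C :=
  if pselect (exists p, P p m) is left e then
    F (projT1 (cid e)) m (rec _ (Plt _ _ (projT2 (cid e)))) else c0.
have G_ext m (f g : forall y, lt y m -> C) :
    (forall y ym, f y ym = g y ym) -> G m f = G m g.
  by move=> fg; rewrite /G; case: pselect => // e; rewrite fg.
exists (Fix wf (fun _ => C) G); split=> [m mP|p m pm].
  rewrite Fix_eq// /G; case: pselect => // e.
  by have [p /mP] := e.
rewrite Fix_eq// {1}/G; case: pselect => [e|[]]; last by exists p.
by case: cid => q /= qm; rewrite (Puniq _ _ _ qm pm).
Qed.

End WellOrder.

Section Labelling.
Context {R : realType} {T : metricType R} (h : T -> R).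
Hypothesis hB : busemann h.
Context {C : Type} (c0 : C) (loc : T -> T -> C).
Hypothesis loc_sep : forall p, separates_branches h p (loc p).
Local Notation s := (meet_height h).
Local Notation up := (up h).
Implicit Types (x y z p q m : T).

(** Given labels loc p of the branches at each p, labels L p are wanted that
    persist for a while along every ray that starts at p. Well-order the tree and
    name a branch by its least element m: at points q a little higher than p, the
    branch that contains m still has m as its least element, so labels that are a
    function lam of m persist.

    Such a function exists because the requirements at different points hardly
    interact. A branch that contains p and starts below p contains everything
    above p; so among the least elements of the branches at p only one, the least
    element mc p above p, can also name a branch at a lower point. Hence at p it
    suffices to exchange two labels, so that mc p receives the label lam (mc p)
    that it already has; any other m naming a branch at p receives its label at p.
    As mc p is smaller than such an m, this is a recursion along the well-order.
    The least element m0 of the whole tree is never assigned a label in this way;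
    it gets c0, which is therefore the label of all branches along the ray
    descending from m0. *)
Lemma coherent_labels (r : T) : exists L : T -> T -> C,
  [/\ forall p, separates_branches h p (L p),
      forall p, hits_all h p (loc p) -> hits_all h p (L p),
      forall p x, up p x -> exists t, [/\ h p < t, t <= h x & forall q,
        above h q x -> h p <= h q < t -> L q x = L p x] &
      exists m0, forall q x, above h q x -> h q < s x m0 -> L q x = c0].
Proof.
have [lt [wf lt_total]] := well_order_strict T.
have [mc mcP] := choice (fun p =>
  least_exists wf (ex_intro (above h p) p (above_refl h p))).
pose P p m := [/\ above h p m, forall y, lt y m -> s y m <= h p & lt (mc p) m].
(* at the height of q, m has parted from all smaller points, hence from mc p,
   while m and mc p are both above p *)
have P_le p q m : P p m -> P q m -> h p <= h q.
  move=> [pm _ mpm] [_ qP _]; apply: le_trans (qP _ mpm).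
  by apply: above_meet => //; have [] := mcP p.
have P_uniq p q m : P p m -> P q m -> p = q.
  move=> pm qm; have [[pm' _ _] [qm' _ _]] := (pm, qm).
  apply: (above_unique hB pm' qm'); apply/eqP.
  by rewrite eq_le (P_le _ _ _ pm qm) (P_le _ _ _ qm pm).
have [lam [lam0 lamP]] := @well_founded_recursion _ _ _ lt P mc
  (fun p m c => transpose (loc p (mc p)) c (loc p m)) c0 wf
  (fun p m pm => let: And3 _ _ mpm := pm in mpm) P_uniq.
pose L p x := transpose (loc p (mc p)) (lam (mc p)) (loc p x).
have L_sep p : separates_branches h p (L p).
  move=> x y px py; rewrite -loc_sep//; split=> [|e]; last by rewrite /L e.
  by move=> e; exact: can_inj (transposeK _ _) _ _ e.
have L_least p x m : up p x -> least lt [set y | h p < s x y] m -> L p x = lam m.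
  move=> px [/= xm m_min]; have pm : up p m.
    split; first by apply: (above_meet_height hB (ltW xm)); case: px.
    by move=> mp; move: xm; rewrite mp ltNge meet_height_ler.
  rewrite (L_sep p x m px pm).2//.
  have [mpm|mpm] := pselect (lt (mc p) m).
    apply: esym; apply: lamP; split=> //; first by case: pm.
    move=> y ym; rewrite leNgt; apply/negP => py; apply: m_min ym => /=.
    by apply: (meet_height_gtrans hB xm); rewrite meet_heightC.
  have -> : m = mc p.
    apply: lt_total => //; have [_] := mcP p; apply; case: pm => //.
  by rewrite /L transpose_l.
exists L; split=> //.
- move=> p loc_surj c.
  have [x px xc] := loc_surj (transpose (loc p (mc p)) (lam (mc p)) c).
  by exists x => //; rewrite /L xc transposeK.
- move=> p x px; have [|m xm] := @least_exists _ lt [set y | h p < s x y] wf.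
    exists x => /=; rewrite meet_heightxx; apply: above_lt; case: px => //.
  exists (s x m).
  split; [by case: xm|exact: meet_height_lel|move=> q qx /andP[pq qm]].
  rewrite (L_least p x m)//; apply: L_least.
    split=> // xq; move: qm; rewrite xq ltNge meet_height_lel//.
  split=> // y /= qy; have [_] := xm; apply => /=; exact: le_lt_trans qy.
- have [m0 [_ m0_min]] := @least_exists _ lt setT wf (ex_intro _ r I).
  exists m0 => q x qx qm.
  rewrite (L_least q x m0); [|split|split].
  + by apply: lam0 => p [_ _] /m0_min; apply.
  + by [].
  + by move=> xq; move: qm; rewrite xq ltNge meet_height_lel.
  + by [].
  + by move=> y _; exact: m0_min.
Qed.

End Labelling.

(** * The tree as a set of label functions *)

Section Embedding.
Context {R : realType} {T : metricType R} (h : T -> R).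
Hypotheses (tree : real_tree T) (hB : busemann h).
Context {C : Type} (c0 : C) (L : T -> T -> C) (m0 : T).
Local Notation d := (@mdist R T).
Local Notation s := (meet_height h).
Local Notation up := (up h).
Hypotheses (L_sep : forall p, separates_branches h p (L p))
  (L_right : forall p x, up p x -> exists t, [/\ h p < t, t <= h x & forall q,
        above h q x -> h p <= h q < t -> L q x = L p x])
  (L_init : forall q x, above h q x -> h q < s x m0 -> L q x = c0).
Implicit Types (x y z p q : T) (t u : R).

Lemma ancestor z x t : above h z x -> h z <= t <= h x ->
  exists p, [/\ above h z p, above h p x & h p = t].
Proof.
move=> zx /andP[zt tx]; have dxz := above_dist zx.
have [|p xpz xp] := tree_geodesic tree (x := x) (y := z) (t := h x - t).
  by rewrite dxz; lra.
move: xpz; rewrite /between xp dxz => pz.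
have hp : h p = t.
  have := height_lipschitz hB x p; have := height_lipschitz hB p z.
  by rewrite xp; lra.
by exists p; rewrite /above /meet_height hp xp; split => //; lra.
Qed.

Lemma up_lt p x t : above h p x -> h p < t -> t <= h x -> up p x.
Proof. by move=> px pt tx; split=> // xp; move: pt; rewrite -xp ltNge tx. Qed.

(** The label at height t of the ray that descends from x; heights outside the
    range of h carry c0. *)
Definition path_label x t : C :=
  if pselect (exists p, up p x /\ h p = t) is left e then L (projT1 (cid e)) x
  else c0.

Lemma path_labelE p x : up p x -> path_label x (h p) = L p x.
Proof.
move=> px; rewrite /path_label; case: pselect => [e|[]]; last by exists p.
case: cid => q /= [[qx _] qp].
by rewrite (above_unique hB qx _ qp)//; case: px.
Qed.

Lemma path_label_out x t : ~ (exists p, up p x /\ h p = t) -> path_label x t = c0.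
Proof. by rewrite /path_label; case: pselect. Qed.

Lemma path_label_init x t : t < s x m0 -> path_label x t = c0.
Proof.
move=> tx; have [[p [px pt]]|] := pselect (exists p, up p x /\ h p = t); last first.
  exact: path_label_out.
by rewrite -pt path_labelE// L_init ?pt//; case: px.
Qed.

Lemma path_label_meet x y t : t < s x y -> path_label x t = path_label y t.
Proof.
have half x' y' : t < s x' y' -> forall p, up p x' /\ h p = t ->
    up p y' /\ path_label x' t = path_label y' t.
  move=> xy p [px pt]; have py : up p y'.
    apply: (@up_lt _ _ (s x' y')); rewrite ?pt ?meet_height_ler//.
    by apply: (above_meet_height hB (x := x')); rewrite ?pt ?ltW//; case: px.
  by split=> //; rewrite -pt !path_labelE//; apply/L_sep; rewrite ?pt.
move=> xy.
have [[p /(half _ _ xy)[]//]|Nx] := pselect (exists p, up p x /\ h p = t).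
have [[p]|Ny] := pselect (exists p, up p y /\ h p = t).
  by rewrite meet_heightC in xy => /(half _ _ xy)[_ ->].
by rewrite !path_label_out.
Qed.

(** If no point has height t, then t is below the height where x and m0 merge,
    and all labels below that height are c0. *)
Lemma path_label_rconst x t : t < h x -> exists e,
  [/\ 0 < e, t + e < h x &
      forall u, t <= u <= t + e -> path_label x u = path_label x t].
Proof.
move=> tx; have [[p [px pt]]|N] := pselect (exists p, up p x /\ h p = t).
  have [t0 [pt0 t0x Lp]] := L_right px; rewrite pt in pt0.
  exists ((t0 - t) / 2); split; [lra|lra|move=> u /andP[tu ut]].
  have [||q [pq qx qu]] := @ancestor p x u; first by case: px.
    by rewrite pt; lra.
  rewrite -qu -pt !path_labelE//; first by apply: Lp => //; rewrite qu; lra.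
  by apply: (up_lt (t := t0)) => //; rewrite qu; lra.
have tm0 : t < s x m0.
  rewrite ltNge; apply/negP => m0t; apply: N.
  have [z [hz zx _]] := meet_point hB x m0.
  have [||p [_ px pt]] := @ancestor z x t => //; first by rewrite hz m0t ltW.
  by exists p; split=> //; apply: (up_lt (t := h x)); rewrite ?pt.
have := meet_height_lel hB x m0 => m0x.
exists ((s x m0 - t) / 2); split; [lra|lra|move=> u ?].
by rewrite !path_label_init//; lra.
Qed.

Lemma path_function : exists f : T -> Aspace R c0,
  forall x, rho (f x) = h x /\ forall t, lab (f x) t = path_label x t.
Proof.
suff ex x : exists g : Aspace R c0,
    rho g = h x /\ forall t, lab g t = path_label x t.
  by have [f fP] := choice ex; exists f.
have l_out t : h x <= t -> path_label x t = c0.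
  move=> xt; apply: path_label_out => -[p [[px xp] pt]].
  by have := above_lt hB px xp; rewrite pt ltNge xt.
have l_init : exists2 tau, tau <= h x & forall t, t < tau -> path_label x t = c0.
  by exists (s x m0); [exact: meet_height_lel|exact: path_label_init].
by exists (@MkAspace R C c0 _ _ l_out l_init (@path_label_rconst x)).
Qed.

Variable f : T -> Aspace R c0.
Hypothesis fP : forall x, rho (f x) = h x /\ forall t, lab (f x) t = path_label x t.

(** Below the point where x and y part their labels agree; at that point their
    labels differ because they are in different branches. *)
Lemma path_separation x y : separation (f x) (f y) = s x y.
Proof.
apply/eqP; rewrite eq_le; apply/andP; split; last first.
  apply: le_separation; split.
    by rewrite le_min (fP x).1 (fP y).1 meet_height_lel// meet_height_ler.
  by move=> t; rewrite (fP x).2 (fP y).2; exact: path_label_meet.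
rewrite leNgt; apply/negP => st.
have := separation_le (f x) (f y); rewrite le_min (fP x).1 (fP y).1 => /andP[sx sy].
have [z [hz zx zy]] := meet_point hB x y.
have zx' := up_lt zx (t := separation (f x) (f y)); rewrite hz in zx'.
have zy' := up_lt zy (t := separation (f x) (f y)); rewrite hz in zy'.
have := separation_agree st.
rewrite (fP x).2 (fP y).2 -hz !path_labelE//; [|exact: zy'|exact: zx'].
by move/(L_sep (zx' st sx) (zy' st sy)); rewrite hz ltxx.
Qed.

Lemma path_isometric : isometric f.
Proof.
move=> x y; rewrite mdist_AspaceE path_separation (fP x).1 (fP y).1 /meet_height.
by lra.
Qed.

(** The truncations of g that come from the tree form a ray, which has an upper
    end e by completeness. If this end were below the end of g, the branch at e
    carrying the next label of g would give longer truncations. *)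
Lemma path_surjective : complete_metric T -> (forall c, exists x, h x < c) ->
  (forall p, hits_all h p (L p)) -> forall g, exists x, f x = g.
Proof.
move=> Tc h_unbounded L_surj g.
pose X := [set p | h p <= rho g /\ forall t, t < h p -> lab g t = path_label p t].
have X_meet p q : X p -> X q -> s p q = Num.min (h p) (h q).
  move=> [pg pl] [qg ql]; apply/eqP; rewrite eq_le.
  rewrite le_min meet_height_lel//= meet_height_ler//= -path_separation.
  apply: le_separation; rewrite /agree /= (fP p).1 (fP q).1; split=> // t.
  by rewrite lt_min (fP p).2 (fP q).2 => /andP[/pl <- /ql <-].
have X0 : X !=set0.
  have [tau taug g0] := lab_init g; have [y ytau] := h_unbounded tau.
  have [z [hz zm0 zy]] := meet_point hB m0 y.
  have zlt : h z < tau by rewrite hz (le_lt_trans _ ytau)// meet_height_ler.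
  exists z; split=> [|t tz]; first by rewrite (le_trans (ltW zlt)).
  by rewrite g0 ?(lt_trans tz)// path_label_init// meet_heightC zm0.
have X_sup : has_sup (h @` X).
  split; first by have [x Xx] := X0; exists (h x), x.
  by exists (rho g) => _ [x [xg _] <-].
have X_dist p q : X p -> X q -> d p q = `|h p - h q|.
  move=> Xp Xq; have := X_meet _ _ Xp Xq; rewrite /meet_height.
  have [pq|qp] := leP (h p) (h q); first by rewrite distrC ger0_norm; lra.
  by rewrite ger0_norm; lra.
have [e eP] := complete_sup_limit Tc X_sup X_dist.
have Kle p : X p -> h p <= sup (h @` X).
  by move=> Xp; apply: sup_upper_bound => //; exists p.
have he : h e = sup (h @` X).
  apply/eqP; rewrite eq_le; apply/andP; split.
    have [p Xp] := X0; have := height_lipschitz hB e p.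
    by rewrite metric_sym eP//; lra.
  have : sup (h @` X) <= (sup (h @` X) + h e) / 2; last by lra.
  apply: ge_sup; first by case: X_sup.
  by move=> _ [p Xp <-]; have := height_lipschitz hB p e; rewrite eP//; lra.
have Xe : X e.
  split=> [|t].
    by rewrite he; apply: ge_sup => [|_ [p [pg _] <-]//]; case: X_sup.
  rewrite he => /(sup_gt X_sup.1)[_ [p Xp <-] tp].
  rewrite (Xp.2 _ tp); apply: path_label_meet.
  by rewrite /meet_height eP// -he; lra.
exists e; have eg := Xe.1.
have e_top : h e = rho g.
  apply/eqP; rewrite eq_le eg /= leNgt; apply/negP => lt_eg.
  (* the point q at height u, on the way from e to a point x in the branch
     labelled lab g (h e), is a truncation of g longer than e *)
  have [eps [eps0 _ g_const]] := lab_rconst lt_eg.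
  have [x ex Lx] := L_surj e (lab g (h e)).
  have [t0 [et0 t0x Lt0]] := L_right ex; have [ex' _] := ex.
  pose u := Num.min (Num.min (h e + eps) (rho g)) ((h e + t0) / 2).
  have eu : h e < u by rewrite /u !lt_min lt_eg; lra.
  have [u1 u2 u3] : [/\ u <= h e + eps, u <= rho g & u <= (h e + t0) / 2].
    have : (u <= h e + eps) && (u <= rho g) && (u <= (h e + t0) / 2).
      by rewrite -!le_min.
    by move=> /andP[/andP[-> ->] ->].
  have [|q [eq qx qu]] := ancestor (t := u) ex'; first by lra.
  suff /Kle : X q by rewrite qu -he leNgt eu.
  split=> [|t]; rewrite qu// => tu.
  have [te|et] := ltP t (h e).
    by rewrite (Xe.2 _ te); apply: path_label_meet; rewrite meet_heightC eq.
  have [|w [ew wq wt]] := ancestor (t := t) eq; first by rewrite qu; lra.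
  have wq' : up w q by apply: (up_lt (t := u)); rewrite ?wt ?qu.
  have wx' : up w x.
    by apply: (up_lt (t := u)); rewrite ?wt//; [exact: above_trans qx|lra].
  rewrite g_const; last by lra.
  rewrite -wt path_labelE// (L_sep wq' wx').2; last first.
    by rewrite meet_heightC qx wt qu.
  rewrite -Lx; apply/esym/Lt0; first by case: wx'.
  by rewrite wt et; lra.
apply: Aspace_eq; first by rewrite (fP e).1.
apply/funext => t; have [te|et] := ltP t (h e).
  by rewrite (fP e).2 (Xe.2 _ te).
by rewrite !lab_out -?e_top// (fP e).1.
Qed.

End Embedding.

(** * Universality and uniqueness *)

Section Coordinates.
Context {R : realType} {T : metricType R} {M C : Type} (c0 : C).
Hypotheses (tree : real_tree T) (CM : label_card M C).

Lemma two_branches (p : T) : `I_2 #<= [set: M] -> branches p #= [set: M] ->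
  exists x y, [/\ x <> p, y <> p & between x p y].
Proof.
move=> M2 pM; have : `I_2 #<= branches p.
  by apply: card_le_trans M2 _; rewrite card_eq_sym in pM; case/card_eqPle: pM.
move=> /pcard_leP /injfunPex[j jp j_inj].
have [x xp xE] := jp 0%N isT; have [y yp yE] := jp 1%N isT.
exists x, y; split=> //; apply: contrapT => /(component_eqP tree xp yp).
by rewrite xE yE => /j_inj; rewrite !inE => /(_ isT isT).
Qed.

(** Where every point has two branches, no point is lowest, since there is only
    one branch at a lowest point; in a complete tree heights are then unbounded
    from below, and surjectivity follows. *)
Lemma tree_coordinates (r : T) : (forall p : T, branches p #<= [set: M]) ->
  exists2 f : T -> Aspace R c0, isometric f &
    `I_2 #<= [set: M] -> complete_metric T ->
    (forall p : T, branches p #= [set: M]) -> forall g, exists x, f x = g.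
Proof.
move=> TM; have [h [hB h_end h_complete]] := busemann_exists tree r.
have loc_ex p : exists l : T -> C, separates_branches h p l /\
    (branches p #= [set: M] -> (exists z, h z < h p) -> hits_all h p l).
  have [l] := local_labels tree hB c0 CM (TM p) (h_end p).
  by exists l.
have [loc locP] := choice loc_ex.
have [L [L_sep L_hits L_right [m0 L_init]]] :=
  coherent_labels hB c0 (fun p => (locP p).1) r.
have [f fP] := path_function tree hB L_right L_init.
exists f => [|M2 Tc pM]; first exact: (path_isometric hB L_sep fP).
have no_lowest p : exists z, h z < h p.
  apply: contrapT => /forallNP p_low.
  have [x [y [xp yp]]] := two_branches M2 (pM p); apply: h_end => // z.
  by rewrite leNgt; apply/negP.
apply: (path_surjective tree hB L_sep L_right L_init fP Tc).
  move=> c; apply: contrapT => /forallNP hc.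
  have [|p p_low] := h_complete c Tc.
    by move=> x; rewrite leNgt; apply/negP.
  by have [z] := no_lowest p; rewrite ltNge p_low.
by move=> p; apply: L_hits; apply: (locP p).2.
Qed.

End Coordinates.

Theorem theorem1p1p3 (R : realType) (M : Type) (C : Type) (c0 : C)
    (M_ge2 : `I_2 #<= [set: M]) (C_card : label_card M C) :
  [/\ universal_real_tree M (Aspace R c0),
      (forall T : metricType R,
         [set: T] !=set0 -> complete_metric T -> real_tree T ->
         (forall t : T, branches t #= [set: M]) ->
         exists f : T -> Aspace R c0, isometry_onto f) &
      homogeneous (Aspace R c0)].
Proof.
split; last exact: Aspace_homogeneous.
- split=> [|S tree SM]; first exact: Aspace_real_tree.
  have [[r _]|S0] := pselect (exists r : S, True); last first.
    exists (fun r => False_rect _ (S0 (ex_intro _ r I))) => r.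
    by case: S0; exists r.
  by have [f f_iso _] := tree_coordinates c0 tree C_card r SM; exists f.
- move=> T [r _] Tc tree TM.
  have [|f f_iso f_surj] := tree_coordinates c0 tree C_card r (M := M).
    by move=> p; have := TM p => /card_eqPle[].
  have [g fg] := choice (f_surj M_ge2 Tc TM).
  exists f; split=> //; exists g => // x; apply: mdist_le0.
  by rewrite -f_iso fg mdistxx.
Qed.
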